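(* Let $\mathcal{H}=(X,\mathcal{F})$ be a finite hypergraph. If Maker has a winning strategy in the $(1:2)$ Maker-Breaker game on $\mathcal{H}$, then Maker has a winning strategy in the stotting Maker-Breaker game on $\mathcal{H}$.
   Context: A hypergraph $\mathcal{H}=(X,\mathcal{F})$ consists of a set $X$ (the board) and a set $\mathcal{F}\subseteq 2^X$ (the winning sets). $(1:2)$ Maker-Breaker game on $\mathcal{H}$: two players, Maker and Breaker, claim previously unclaimed elements of $X$ in turns until all elements are claimed; in each turn Breaker first claims two elements and then Maker claims one element (as long as unclaimed elements are available). So Breaker makes the first move. Maker wins if at the end Maker has claimed all elements of some $F\in\mathcal{F}$; otherwise Breaker wins. Stotting Maker-Breaker game on $\mathcal{H}$: the players claim unclaimed elements in turns, each turn consisting of two moves, one by Maker and one by Breaker, each move claiming one unclaimed element; before each turn Breaker decides which of the two players moves first in that turn. (If only one unclaimed element remains, the player chosen to go first claims it and the game ends.) Maker wins if at the end Maker has claimed all elements of some $F\in\mathcal{F}$; otherwise Breaker wins. *)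

(* Defs.v *)
From HB Require Import structures.
From mathcomp Require Import all_boot.

Set Implicit Arguments.
Unset Strict Implicit.
Unset Printing Implicit Defensive.

Inductive player : Type := Maker | Breaker.

Definition is_maker (p : player) : bool := if p is Maker then true else false.

Lemma is_makerK :
  cancel is_maker (fun b : bool => if b then Maker else Breaker).
Proof. by case. Qed.

HB.instance Definition _ := Equality.copy player (can_type is_makerK).

Section Game.

Variable X : finType.

(* The claims made so far, oldest first. *)
Definition history : Type := seq (player * X).

Definition claimed (h : history) : {set X} := [set:: map snd h].

Definition claimed_by (p : player) (h : history) : {set X} :=
  [set:: [seq m.2 | m <- h & m.1 == p]].

(* [ord h p] means that the rules allow [p] to make the move following [h].
   When both players are allowed, the choice between them is Breaker's: Maker's
   strategy has to cope with either. *)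
Definition move_order : Type := history -> player -> bool.

(* (1:2) game: every turn is Breaker, Breaker, Maker. *)
Definition one_two_order : move_order := fun h p =>
  p == (if size h %% 3 == 2 then Maker else Breaker).

(* Stotting game: turns are pairs of consecutive moves. Either player may make
   the first one, and the other player makes the second. Maker learns Breaker's
   decision by being asked to move after a history of even length. The default
   value of [last] is never used, since an odd-length history is nonempty. *)
Definition stotting_order : move_order := fun h p =>
  odd (size h) ==> (p != last Breaker (map fst h)).

(* The strategy is option-valued so that strategies exist on the empty board. *)
Definition strategy : Type := history -> option X.

(* The histories that can arise when Maker follows [s] and Breaker plays
   arbitrarily. *)
Inductive play (ord : move_order) (s : strategy) : history -> Prop :=
| play_nil : play ord s [::]
| play_maker h x of play ord s h & ord h Maker & x \notin claimed h
    & s h = Some x : play ord s (rcons h (Maker, x))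
| play_breaker h x of play ord s h & ord h Breaker & x \notin claimed h :
    play ord s (rcons h (Breaker, x)).

(* Whenever Maker has to move, [s] provides a legal move; without this clause a
   strategy that gets stuck would win vacuously. *)
Definition legal_strategy (ord : move_order) (s : strategy) : Prop :=
  forall h, play ord s h -> ord h Maker -> claimed h != setT ->
    exists2 x, s h = Some x & x \notin claimed h.

Definition winning_strategy (ord : move_order) (F : {set {set X}})
    (s : strategy) : Prop :=
  legal_strategy ord s /\
  forall h, play ord s h -> claimed h = setT ->
    exists2 A, A \in F & A \subset claimed_by Maker h.

Definition maker_has_winning_strategy (ord : move_order)
    (F : {set {set X}}) : Prop :=
  exists s : strategy, winning_strategy ord F s.

End Game.

Arguments one_two_order {X}.
Arguments stotting_order {X}.

(* Main.v *)
Require Import Defs.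
From mathcomp Require Import all_boot.
From mathcomp Require Import zify.

(** Maker plays the stotting game by keeping a shadow (1:2) game in which she
    follows her winning strategy [s].  Each real move of Breaker is copied into
    the shadow game at once, unless the element is already claimed there.  When
    Maker has to move, the current Breaker pair of the shadow game is completed
    with arbitrary fake claims, and she plays the answer of [s] in both games.

    Copying never overflows a Breaker pair: a shadow pair is closed at every
    Maker move, and between two consecutive Maker moves of a stotting game
    Breaker moves at most twice, which [slack] keeps track of.  Fake claims only
    harm Maker: both games give her the same elements, and everything claimed in
    the real game is claimed in the shadow game, so the answer of [s] is a legal
    real move.  If the shadow board is exhausted, then Maker already owns a
    winning set there, hence in the real game, and may play arbitrarily from
    then on.  So [shadowed] persists until Maker owns a winning set
    ([shadowed_play]), and a full real board comes with a full shadow board. *)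

Lemma claimed_rcons {X : finType} (h : history X) (m : player * X) :
  claimed (rcons h m) = m.2 |: claimed h.
Proof.
by apply/setP=> x; rewrite /claimed map_rcons !inE mem_rcons inE.
Qed.

Lemma claimed_by_rcons {X : finType} (p : player) (h : history X)
    (m : player * X) :
  claimed_by p (rcons h m) =
    if m.1 == p then m.2 |: claimed_by p h else claimed_by p h.
Proof.
apply/setP=> x; rewrite /claimed_by filter_rcons.
by case: ifP => _; rewrite ?map_rcons !inE ?mem_rcons ?inE.
Qed.

Definition maker_won {X : finType} (F : {set {set X}}) (h : history X) : Prop :=
  exists2 A, A \in F & A \subset claimed_by Maker h.

Lemma maker_won_rcons {X : finType} (F : {set {set X}}) (h : history X)
    (m : player * X) :
  maker_won F h -> maker_won F (rcons h m).
Proof.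
case=> A AF Ah; exists A => //; apply: subset_trans Ah _.
by rewrite claimed_by_rcons; case: ifP => // _; apply: subsetUr.
Qed.

Definition pad {X : finType} (g : history X) : history X :=
  if size g %% 3 == 2 then g
  else if [pick x | x \notin claimed g] is Some x then rcons g (Breaker, x)
  else g.

(** Unless the board runs out, two paddings reach the next turn of Maker, since
    she moves at the histories of size 2 modulo 3. *)
Definition pad_pair {X : finType} (g : history X) : history X := pad (pad g).

Lemma pad_play {X : finType} (s : strategy X) (g : history X) :
  play one_two_order s g ->
  [/\ play one_two_order s (pad g),
      claimed_by Maker (pad g) = claimed_by Maker g
    & claimed g \subset claimed (pad g)].
Proof.
move=> gP; rewrite /pad; case: ifPn => // g3.
case: pickP => [x xg|_] //; split.
- by apply: play_breaker; rewrite // /one_two_order (negbTE g3).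
- by rewrite claimed_by_rcons.
- by rewrite claimed_rcons subsetUr.
Qed.

Lemma pad_size {X : finType} (g : history X) :
  claimed (pad g) <> setT ->
  size (pad g) %% 3 = if size g %% 3 == 2 then 2 else (size g).+1 %% 3.
Proof.
rewrite /pad; case: eqP => [-> //|_].
case: pickP => [x _ _|full notT]; first by rewrite size_rcons.
by case: notT; apply/setP=> x; rewrite in_setT; apply: negbFE (full x).
Qed.

Lemma pad_pair_play {X : finType} (s : strategy X) (g : history X) :
  play one_two_order s g ->
  [/\ play one_two_order s (pad_pair g),
      claimed_by Maker (pad_pair g) = claimed_by Maker g
    & claimed g \subset claimed (pad_pair g)].
Proof.
move=> /pad_play[gP gM gS]; have [ggP ggM ggS] := pad_play _ _ gP.
by split; rewrite // ?ggM //; apply: subset_trans gS ggS.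
Qed.

Lemma pad_pair_size {X : finType} (g : history X) :
  claimed (pad_pair g) != setT -> size (pad_pair g) %% 3 = 2.
Proof.
move=> notT; have pad_notT : claimed (pad g) <> setT.
  move=> fullg; case/eqP: notT; rewrite /pad_pair {1}/pad.
  by case: ifP => _ //; case: pickP => // x; rewrite fullg in_setT.
have := pad_size g pad_notT; have := pad_size _ (elimN eqP notT).
by rewrite -/(pad_pair g); case: eqP => //; case: eqP => //; lia.
Qed.

Definition shadow_step {X : finType} (g : history X) (m : player * X) :
    history X :=
  if m.1 is Maker then rcons (pad_pair g) m
  else if m.2 \in claimed g then g else rcons g m.

Definition shadow {X : finType} (h : history X) : history X :=
  foldl shadow_step [::] h.

Lemma shadow_rcons {X : finType} (h : history X) (m : player * X) :
  shadow (rcons h m) = shadow_step (shadow h) m.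
Proof. by rewrite /shadow foldl_rcons. Qed.

(** The arbitrary legal move is the fallback for when the shadow game is over;
    it makes the strategy legal independently of any invariant. *)
Definition shadow_strategy {X : finType} (s : strategy X) : strategy X :=
  fun h => if s (pad_pair (shadow h)) is Some x then
             if x \notin claimed h then Some x
             else [pick y | y \notin claimed h]
           else [pick y | y \notin claimed h].

Lemma shadow_strategy_legal {X : finType} (ord : move_order X)
    (s : strategy X) :
  legal_strategy ord (shadow_strategy s).
Proof.
move=> h _ _ notT.
have [y yP yh] : exists2 y, [pick y | y \notin claimed h] = Some y
                          & y \notin claimed h.
  case: pickP => [y yh|full]; first by exists y.
  by case/eqP: notT; apply/setP=> y; rewrite in_setT; apply: negbFE (full y).
rewrite /shadow_strategy yP; case: (s _) => [x|]; last by exists y.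
by case: ifP => [xh|_]; [exists x | exists y].
Qed.

(** An upper bound on the number of Breaker moves since the last move of Maker
    in a stotting game.  Between turns it is 1, because Maker moved in the last
    turn, if any; after the first move of a turn it is 0 or 2, according to who
    made that move. *)
Definition slack {X : finType} (h : history X) : nat :=
  if odd (size h) then
    if last Breaker (map fst h) is Maker then 0 else 2
  else 1.

(** The order of moves matters here: the equation is false after a Breaker move
    that opens a turn, and then Breaker must not move again.  Since
    slack never exceeds 2, it is at most 1 whenever Breaker may move, so that
    his move still fits into the open Breaker pair of the shadow game. *)
Lemma slack_breaker {X : finType} (h : history X) (x : X) :
  stotting_order h Breaker -> slack (rcons h (Breaker, x)) = (slack h).+1.
Proof.
rewrite /stotting_order /slack size_rcons map_rcons last_rcons /=.
by case: odd => //=; case: last.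
Qed.

Lemma slack_le2 {X : finType} (h : history X) : slack h <= 2.
Proof. by rewrite /slack; case: odd => //; case: last. Qed.

(** The open Breaker pair of the shadow game may be smaller than [slack] says,
    notably because real moves on fake claims are not copied: hence the
    inequality. *)
Definition shadowed {X : finType} (s : strategy X) (h : history X) : Prop :=
  [/\ play one_two_order s (shadow h),
      claimed_by Maker (shadow h) = claimed_by Maker h,
      claimed h \subset claimed (shadow h)
    & size (shadow h) %% 3 <= slack h].

Lemma shadowed_breaker {X : finType} (s : strategy X) (h : history X) (x : X) :
  stotting_order h Breaker -> shadowed s h ->
  shadowed s (rcons h (Breaker, x)).
Proof.
move=> hB [gP gM gS g3]; have slackS := slack_breaker h x hB.
have slack_le1 : slack h <= 1 by rewrite -ltnS -slackS slack_le2.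
rewrite /shadowed shadow_rcons slackS claimed_rcons claimed_by_rcons /=.
rewrite /shadow_step /=; case: ifPn => xg.
  by split=> //; [rewrite subUset sub1set xg | apply: leqW].
split.
- apply: play_breaker => //; rewrite /one_two_order.
  by rewrite ltn_eqF // (leq_ltn_trans g3).
- by rewrite claimed_by_rcons.
- by rewrite claimed_rcons setUS.
- by rewrite size_rcons; lia.
Qed.

(** If completing the Breaker pair exhausts the shadow board, that game has
    ended with a win of Maker, who owns the same elements in the real game.
    Otherwise the answer of [s] is unclaimed in the shadow game, hence in the
    real one, so [shadow_strategy] does not resort to its fallback. *)
Lemma shadowed_maker {X : finType} (F : {set {set X}}) (s : strategy X)
    (h : history X) (x : X) :
  winning_strategy one_two_order F s -> shadow_strategy s h = Some x ->
  shadowed s h ->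
  maker_won F h \/ shadowed s (rcons h (Maker, x)).
Proof.
move=> [s_legal s_wins] hx [gP gM gS _].
have [ggP ggM ggS] := pad_pair_play _ _ gP.
have [full|notT] := eqVneq (claimed (pad_pair (shadow h))) setT.
  by left; rewrite /maker_won -gM -ggM; apply: s_wins.
right; have size2 := pad_pair_size _ notT.
have turn : one_two_order (pad_pair (shadow h)) Maker.
  by rewrite /one_two_order size2.
have [y sy yg] := s_legal _ ggP turn notT.
have hS := subset_trans gS ggS.
have yx : y = x.
  move: hx; rewrite /shadow_strategy sy.
  by rewrite (contraNN (subsetP hS y) yg) => -[].
rewrite {y}yx in sy yg.
rewrite /shadowed shadow_rcons /shadow_step /=; split.
- exact: play_maker.
- by rewrite !claimed_by_rcons /= ggM gM.
- by rewrite !claimed_rcons setUS.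
- by rewrite size_rcons; lia.
Qed.

Lemma shadowed_play {X : finType} (F : {set {set X}}) (s : strategy X)
    (h : history X) :
  winning_strategy one_two_order F s ->
  play stotting_order (shadow_strategy s) h ->
  maker_won F h \/ shadowed s h.
Proof.
move=> s_win; elim=> {h} [|h x _ [won|sh] _ _ hx|h x _ [won|sh] hB _].
- by right; split=> //; apply: play_nil.
- by left; apply: maker_won_rcons.
- have [won|] := shadowed_maker _ _ _ _ s_win hx sh; last by right.
  by left; apply: maker_won_rcons.
- by left; apply: maker_won_rcons.
- by right; apply: shadowed_breaker.
Qed.

Theorem proposition2p1 (X : finType) (F : {set {set X}}) :
  maker_has_winning_strategy one_two_order F ->
  maker_has_winning_strategy stotting_order F.
Proof.
case=> s s_win; exists (shadow_strategy s).
split=> [|h hP full]; first exact: shadow_strategy_legal.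
have [//|[gP gM gS _]] := shadowed_play _ _ _ s_win hP.
rewrite -gM; apply: (proj2 s_win) => //.
by apply/eqP; rewrite -subTset -full.
Qed.
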